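(* Let $m$ be a natural number. Let $S$ be a finite set, let $n\in\mathbb{N}$, let $X_1,\ldots,X_n$ be $2m$-wise independent random variables taking values in $S$, let $0<\alpha<1$ and $0<p<1$, and let $f:S^n\to[-1,1]$ be any function. Then there exists a set $C\subseteq[n]$ of size $|C|\le \frac{8m}{p\alpha^2}$ such that for all $T\subseteq[n]\setminus C$ of size $|T|\le m$, the set $T$ is not $(p,\alpha)$-pivotal in $f$ with respect to $X=(X_1,\ldots,X_n)$.
   Context: Write $[n]=\{1,\ldots,n\}$ and write $f$ for the random variable $f(X)$. Random variables $X_1,\ldots,X_n$ are $k$-wise independent if for every subset $T\subseteq[n]$ with $|T|\le k$, the random variables $\{X_i:i\in T\}$ are independent. For $T\subseteq[n]$, let $X_T=(X_i)_{i\in T}$. For $p,\alpha\in\mathbb{R}$, a set $T\subseteq[n]$ is called $(p,\alpha)$-pivotal in $f$ with respect to $X$ if $$\Pr\Big[\big|\mathbb{E}[f\mid X_T]-\mathbb{E}[f]\big|>\alpha\Big]>p.$$ *)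

(* Defs.v *)
From HB Require Import structures.
From mathcomp Require Import all_boot all_order all_algebra.
From mathcomp Require Import all_classical all_reals all_analysis.

Set Implicit Arguments.
Unset Strict Implicit.
Unset Printing Implicit Defensive.

Import Order.TTheory GRing.Theory Num.Theory.
Import numFieldNormedType.Exports.

Local Open Scope classical_set_scope.
Local Open Scope ring_scope.

Section FiniteValuedRandomVariables.
Context {d : measure_display} {Omega : measurableType d} {R : realType}.
Variable P : probability Omega R.

(* Measurability of Y with respect to the discrete sigma-algebra on S; stated
   on events so that S does not need to carry a measurableType structure. *)
Definition discrete_rv (S : finType) (Y : Omega -> S) : Prop :=
  forall A : set S, measurable (Y @^-1` A).

Definition mutually_independent (S : finType) (n : nat) (T : {set 'I_n})
    (X : 'I_n -> Omega -> S) : Prop :=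
  forall A : 'I_n -> set S,
    P (\bigcap_(i in [set` T]) (X i @^-1` A i))
    = (\prod_(i in T) P (X i @^-1` A i))%E.

Definition kwise_independent (S : finType) (n k : nat)
    (X : 'I_n -> Omega -> S) : Prop :=
  forall T : {set 'I_n}, (#|T| <= k)%N -> mutually_independent T X.

Definition expect (Z : Omega -> R) : R := fine 'E_P[Z]%E.

(* Conditional expectation E[Z | Y] for Y with finitely many values, as a random
   variable: at w it is E[Z 1_{Y = Y w}] / P(Y = Y w).  The division is junk (0)
   only on the null event where P(Y = Y w) = 0. *)
Definition condexp (U : finType) (Z : Omega -> R) (Y : Omega -> U)
    (w : Omega) : R :=
  expect (Z \* \1_(Y @^-1` [set Y w])) / fine (P (Y @^-1` [set Y w])).

Definition joint (S : finType) (n : nat) (X : 'I_n -> Omega -> S)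
    (w : Omega) : {ffun 'I_n -> S} :=
  [ffun i => X i w].

Definition subjoint (S : finType) (n : nat) (T : {set 'I_n})
    (X : 'I_n -> Omega -> S) (w : Omega) : {ffun {i : 'I_n | i \in T} -> S} :=
  [ffun i => X (val i) w].

Definition pivotal (S : finType) (n : nat) (p alpha : R)
    (f : {ffun 'I_n -> S} -> R) (X : 'I_n -> Omega -> S)
    (T : {set 'I_n}) : Prop :=
  let fX := f \o joint X in
  (p%:E < P [set w | (alpha <
     `|condexp fX (subjoint T X) w - expect fX|)%R])%E.

End FiniteValuedRandomVariables.

(* Main.v *)
Require Import Defs.
From HB Require Import structures.
From mathcomp Require Import all_boot all_order all_algebra.
From mathcomp Require Import all_classical all_reals all_analysis.
From mathcomp Require Import ring lra.

Import Order.TTheory GRing.Theory Num.Theory.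
Import numFieldNormedType.Exports.

Local Open Scope classical_set_scope.
Local Open Scope ring_scope.

(** Conditional means of [f] given disjoint blocks of coordinates deviate from
    the mean of [f] in orthogonal directions, and a function of norm at most 1
    has room for only few directions in which it projects substantially.

    For a block [T], let [D_T] be the random variable E[f | X_T] - E[f]
    ([deviation]).  It is centred, and it is the projection of [f] to the
    centred functions of [X_T], so that E[f D_T] = E[D_T ^ 2]
    ([mean_mul_deviation]).  If [T] is (p, alpha)-pivotal, then
    E[D_T ^ 2] > p alpha ^ 2 ([lt_mean_sqr]).  If [T1] and [T2] are disjoint of
    size at most m, then 2m-wise independence makes [X_T1] and [X_T2]
    independent ([indep_restr]), hence
    E[D_T1 D_T2] = E[D_T1] E[D_T2] = 0.  For a family of pairwise disjoint
    pivotal sets of size at most m, Bessel's inequality ([bessel]) thus gives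

      (number of sets) * p alpha ^ 2 <= \sum_T E[D_T ^ 2] <= E[f ^ 2] <= 1

    ([card_large_deviation]).  Take such a family with the largest number of
    sets and let [C] be its union.  By maximality every small pivotal set meets
    [C], and [C] has at most m / (p alpha ^ 2) elements, an eighth of
    the stated bound.

    Only finitely many values are involved, so all the means are computed on the
    finite space of tuples with the law of the joint variable; [expect_law],
    [prob_law] and [condexp_law] carry the quantities on the original
    probability space over to it. *)

(** * Conditional means on a finite probability space *)

Section FiniteProbability.
Context {R : realFieldType} {W : finType} (mu : W -> R).

Definition prob (A : pred W) : R := \sum_(x | A x) mu x.

Definition mean (g : W -> R) : R := \sum_x mu x * g x.

Definition cmean {U : finType} (Y : W -> U) (f : W -> R) (x : W) : R :=
  (\sum_(y | Y y == Y x) mu y * f y) / prob (fun y => Y y == Y x).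

Definition deviation {U : finType} (Y : W -> U) (f : W -> R) (x : W) : R :=
  cmean Y f x - mean f.

Definition indep {U V : finType} (Y : W -> U) (Z : W -> V) : Prop :=
  forall u v, prob (fun x => (Y x == u) && (Z x == v))
              = prob (fun x => Y x == u) * prob (fun x => Z x == v).

Lemma meanD g h : mean (fun x => g x + h x) = mean g + mean h.
Proof. by rewrite -big_split; apply: eq_bigr => x _; rewrite mulrDr. Qed.

Lemma meanZ a g : mean (fun x => a * g x) = a * mean g.
Proof. by rewrite mulr_sumr; apply: eq_bigr => x _; rewrite mulrCA. Qed.

Lemma mean_sum {I : Type} (s : seq I) (Q : pred I) (g : I -> W -> R) :
  mean (fun x => \sum_(i <- s | Q i) g i x) = \sum_(i <- s | Q i) mean (g i).
Proof.
by rewrite [RHS]exchange_big; apply: eq_bigr => x _; rewrite mulr_sumr.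
Qed.

Lemma mean_fiber {U : finType} (Y : W -> U) (h : U -> R) :
  mean (fun x => h (Y x)) = \sum_u prob (fun x => Y x == u) * h u.
Proof.
rewrite /mean (partition_big Y predT)//=; apply: eq_bigr => u _.
by rewrite mulr_suml; apply: eq_bigr => x /eqP->.
Qed.

Lemma mean_indepM {U V : finType} (Y : W -> U) (Z : W -> V)
    (g : U -> R) (h : V -> R) :
  indep Y Z ->
  mean (fun x => g (Y x) * h (Z x))
  = mean (fun x => g (Y x)) * mean (fun x => h (Z x)).
Proof.
move=> indYZ; rewrite !mean_fiber big_distrlr/= pair_bigA/=.
rewrite (mean_fiber (fun x => (Y x, Z x)) (fun q => g q.1 * h q.2)).
apply: eq_bigr => -[u v] _ /=.
rewrite (_ : prob _ = prob (fun x => (Y x == u) && (Z x == v))); last first.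
  by apply: eq_bigl => x; rewrite xpair_eqE.
by rewrite indYZ; ring.
Qed.

(** Brings deviations into the form to which [mean_indepM] and [mean_cmeanM]
    apply. *)
Lemma cmean_comp {U : finType} (Y : W -> U) f :
  exists g : U -> R, forall x, cmean Y f x = g (Y x).
Proof.
by exists (fun u =>
  (\sum_(y | Y y == u) mu y * f y) / prob (fun y => Y y == u)).
Qed.

Hypothesis mu_ge0 : forall x, 0 <= mu x.

Lemma mean_ge0 g : (forall x, 0 <= g x) -> 0 <= mean g.
Proof. by move=> g0; apply: sumr_ge0 => x _; rewrite mulr_ge0. Qed.

Lemma mean_le g h : (forall x, g x <= h x) -> mean g <= mean h.
Proof. by move=> gh; apply: ler_sum => x _; rewrite ler_wpM2l. Qed.

(** Both sides agree on each fibre of [Y], where [h \o Y] is constant.  On a fibre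
    of mass zero the quotient defining [cmean] is junk, but then every point of
    the fibre has mass zero and both sides vanish. *)
Lemma mean_cmeanM {U : finType} (Y : W -> U) f (h : U -> R) :
  mean (fun x => f x * h (Y x)) = mean (fun x => cmean Y f x * h (Y x)).
Proof.
rewrite /mean (partition_big Y predT)//= [RHS](partition_big Y predT)//=.
apply: eq_bigr => u _.
set N := \sum_(y | Y y == u) mu y * f y.
set D := prob (fun y => Y y == u).
transitivity (N * h u).
  by rewrite mulr_suml; apply: eq_bigr => x /eqP->; rewrite mulrA.
transitivity (D * (N / D * h u)); last first.
  by rewrite mulr_suml; apply: eq_bigr => x /eqP Yx; rewrite /cmean Yx.
have [D0|D0] := eqVneq D 0; last by field.
suff -> : N = 0 by rewrite !mul0r mulr0.
move/eqP: D0; rewrite psumr_eq0// => /allP D0.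
rewrite /N big1// => x Yx.
by have /implyP/(_ Yx)/eqP-> := D0 x (mem_index_enum x); rewrite mul0r.
Qed.

(** The mean of the square of [h - \sum_j D j] is nonnegative. *)
Lemma bessel {I : finType} (J : {set I}) (D : I -> W -> R) (h : W -> R) :
  {in J, forall j, mean (fun x => h x * D j x) = mean (fun x => D j x ^+ 2)} ->
  {in J &, forall i j, i != j -> mean (fun x => D i x * D j x) = 0} ->
  \sum_(j in J) mean (fun x => D j x ^+ 2) <= mean (fun x => h x ^+ 2).
Proof.
move=> hD DD; set q := \sum_(j in J) _.
pose G x := \sum_(j in J) D j x.
have hG : mean (fun x => h x * G x) = q.
  rewrite /q -(eq_bigr _ hD) -mean_sum; apply: eq_bigr => x _.
  by rewrite mulr_sumr.
have GG : mean (fun x => G x * G x) = q.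
  rewrite (_ : mean _ = \sum_(i in J) \sum_(j in J)
                           mean (fun x => D i x * D j x)); last first.
    under eq_bigr do rewrite -mean_sum.
    by rewrite -mean_sum; apply: eq_bigr => x _; rewrite big_distrlr.
  apply: eq_bigr => i iJ; rewrite (bigD1 i)//= [X in _ + X]big1 ?addr0//.
  by move=> j /andP[jJ ji]; rewrite DD// eq_sym.
have : 0 <= mean (fun x => (h x - G x) ^+ 2).
  by apply: mean_ge0 => x; rewrite sqr_ge0.
rewrite (_ : mean _ = mean (fun x => h x ^+ 2)
                       + (-2 * mean (fun x => h x * G x)
                          + mean (fun x => G x * G x))); last first.
  by rewrite -meanZ -!meanD; apply: eq_bigr => x _; ring.
by rewrite hG GG; lra.
Qed.

(** Chebyshev's inequality. *)
Lemma lt_mean_sqr g (p alpha : R) :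
  0 < alpha -> p < prob (fun x => alpha < `|g x|) ->
  p * alpha ^+ 2 < mean (fun x => g x ^+ 2).
Proof.
move=> a0 pg; have a20 : 0 < alpha ^+ 2 by rewrite exprn_gt0.
apply: (@lt_le_trans _ _ (prob (fun x => alpha < `|g x|) * alpha ^+ 2)).
  by rewrite ltr_pM2r.
rewrite /prob mulr_suml big_mkcond; apply: ler_sum => x _.
case: ifPn => [ag|_]; last by rewrite mulr_ge0// sqr_ge0.
by rewrite ler_wpM2l// -(real_normK (num_real (g x))) lerXn2r ?nnegrE// ?ltW.
Qed.

Hypothesis mu1 : \sum_x mu x = 1.

Lemma mean_cst a : mean (fun=> a) = a.
Proof. by rewrite /mean -mulr_suml mu1 mul1r. Qed.

Lemma mean_deviation {U : finType} (Y : W -> U) f : mean (deviation Y f) = 0.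
Proof.
rewrite /deviation meanD mean_cst.
rewrite (_ : mean _ = mean f) ?subrr//.
transitivity (mean (fun x => cmean Y f x * 1)).
  by apply: eq_bigr => x _; rewrite mulr1.
rewrite -(mean_cmeanM Y f (fun=> 1)).
by apply: eq_bigr => x _; rewrite mulr1.
Qed.

Lemma deviation_cst {U : finType} (Y : W -> U) f :
  (forall x y, Y x = Y y) -> forall x, deviation Y f x = 0.
Proof.
move=> Ycst x; rewrite /deviation /cmean /prob.
have YT : (fun y => Y y == Y x) =1 predT by move=> y; apply/eqP.
by rewrite !(eq_bigl _ _ YT) mu1 divr1 subrr.
Qed.

(** The deviation is the projection of [f] to the centred functions of [Y]:
    conditioning on [Y] replaces [f] by [cmean Y f], which differs from the
    deviation by a constant, and constants are orthogonal to it. *)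
Lemma mean_mul_deviation {U : finType} (Y : W -> U) f :
  mean (fun x => f x * deviation Y f x)
  = mean (fun x => deviation Y f x ^+ 2).
Proof.
have [g cE] := cmean_comp Y f.
have dE x : deviation Y f x = g (Y x) - mean f by rewrite /deviation cE.
transitivity (mean (fun x => f x * (g (Y x) - mean f))).
  by apply: eq_bigr => x _; rewrite dE.
rewrite (mean_cmeanM Y f (fun u => g u - mean f)).
transitivity (mean (fun x => deviation Y f x ^+ 2 + mean f * deviation Y f x)).
  by apply: eq_bigr => x _; rewrite -dE /deviation; ring.
by rewrite meanD meanZ mean_deviation mulr0 addr0.
Qed.

(** Pairwise independence makes the deviations orthogonal, and the deviation
    of [f] along [Y j] is the projection of [f] to the centred functions of
    [Y j]; so Bessel's inequality bounds the sum of their squared norms by that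
    of [f], and each summand exceeds [p * alpha ^+ 2]. *)
Lemma card_large_deviation {I : finType} (J : {set I}) (U : I -> finType)
    (Y : forall i, W -> U i) (f : W -> R) (p alpha : R) :
  (forall x, -1 <= f x <= 1) -> 0 < alpha ->
  {in J &, forall i j, i != j -> indep (Y i) (Y j)} ->
  {in J, forall j, p < prob (fun x => alpha < `|deviation (Y j) f x|)} ->
  #|J|%:R * (p * alpha ^+ 2) <= 1.
Proof.
move=> f1 a0 indY devY.
apply: (@le_trans _ _ (\sum_(j in J) mean (fun x => deviation (Y j) f x ^+ 2))).
  rewrite mulr_natl -sumr_const; apply: ler_sum => j jJ.
  exact/ltW/lt_mean_sqr/devY.
apply: (@le_trans _ _ (mean (fun x => f x ^+ 2))); last first.
  rewrite -[leRHS](mean_cst 1); apply: mean_le => x.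
  by have /andP[] := f1 x; nra.
apply: bessel => [j _|i j iJ jJ ij]; first exact: mean_mul_deviation.
have [g gE] := cmean_comp (Y i) f; have [h hE] := cmean_comp (Y j) f.
have giE x : deviation (Y i) f x = g (Y i x) - mean f by rewrite /deviation gE.
have hjE x : deviation (Y j) f x = h (Y j x) - mean f by rewrite /deviation hE.
transitivity (mean (fun x => (g (Y i x) - mean f) * (h (Y j x) - mean f))).
  by apply: eq_bigr => x _; rewrite giE hjE.
rewrite (mean_indepM _ _ (fun u => g u - mean f) (fun v => h v - mean f)
           (indY _ _ iJ jJ ij)).
rewrite [X in X * _](_ : _ = mean (deviation (Y i) f)).
  by rewrite mean_deviation mul0r.
by apply: eq_bigr => x _; rewrite giE.
Qed.

End FiniteProbability.

(** * The law of a random variable with finitely many values *)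

Section Law.
Context {d : measure_display} {Omega : measurableType d} {R : realType}.
Variable P : probability Omega R.
Context {W : finType} (J : Omega -> W).
Hypothesis mJ : discrete_rv J.

Definition law (x : W) : R := fine (P (J @^-1` [set x])).

Lemma law_ge0 x : 0 <= law x.
Proof. exact/fine_ge0/measure_ge0. Qed.

(** [g \o J] is the combination of the indicators of the fibres of [J] with the
    values of [g] as coefficients. *)
Lemma expect_law (g : W -> R) : expect P (g \o J) = mean law g.
Proof.
have gJE w : (g (J w))%:E
    = (\sum_(x : W) (g x)%:E * (\1_(J @^-1` [set x]) w)%:E)%E.
  rewrite (bigD1 (J w))//= indicE mem_set// mule1 big1 ?adde0// => x xJ.
  rewrite indicE memNset ?mule0// => /= Jw.
  by rewrite Jw eqxx in xJ.
rewrite /expect unlock; under eq_integral do rewrite /= gJE.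
have mJx x : measurable (J @^-1` [set x]) by exact: mJ.
have iJ x := integrable_indic P (mJx x).
rewrite integral_sum//; last by move=> x; apply: integrableZl.
rewrite (_ : (\sum_(x : W) _)%E = (\sum_(x : W) (law x * g x)%:E)%E).
  by rewrite sumEFin.
apply: eq_bigr => x _; rewrite integralZl// integral_indic// setIT.
by rewrite EFinM muleC /law fineK// fin_num_measure.
Qed.

Lemma prob_law (A : pred W) : P (J @^-1` [set x | A x]) = (prob law A)%:E.
Proof.
have mA : measurable (J @^-1` [set x | A x]) by exact: mJ.
rewrite -[LHS]fineK ?fin_num_measure//; congr EFin.
rewrite -expectation_indic//.
transitivity (expect P ((fun x => (A x)%:R) \o J)).
  congr (fine (expectation.body P _)); apply/funext => w /=; rewrite indicE.
  by congr (nat_of_bool _)%:R; apply/idP/idP => [/set_mem//|Aw]; apply/mem_set.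
rewrite expect_law /mean /prob [RHS]big_mkcond.
by apply: eq_bigr => x _; case: (A x); rewrite ?mulr1 ?mulr0.
Qed.

Lemma sum_law : \sum_x law x = 1.
Proof.
have := prob_law predT; rewrite (_ : _ @^-1` _ = setT); last first.
  by apply/seteqP; split.
by rewrite probability_setT => -[].
Qed.

Lemma condexp_law {U : finType} (Y : W -> U) (g : W -> R) (w : Omega) :
  condexp P (g \o J) (Y \o J) w = cmean law Y g (J w).
Proof.
rewrite /condexp /cmean; congr (_ / _).
  transitivity (expect P ((fun x => g x * (Y x == Y (J w))%:R) \o J)).
    congr (expect P _); apply/funext => v /=; rewrite indicE.
    congr (_ * (nat_of_bool _)%:R).
    by apply/idP/eqP => [/set_mem//|Yv]; apply/mem_set.
  rewrite expect_law [RHS]big_mkcond; apply: eq_bigr => x _.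
  by case: ifP; rewrite ?mulr1 ?mulr0.
rewrite (_ : _ @^-1` _ = J @^-1` [set x | Y x == Y (J w)]) ?prob_law//.
by apply/seteqP; split => v /= /eqP.
Qed.

End Law.

(** * Restrictions of a tuple of random variables *)

Section Restriction.
Context {d : measure_display} {Omega : measurableType d} {R : realType}.
Variable P : probability Omega R.
Context {S : finType} {n : nat} (X : 'I_n -> Omega -> S).
Hypothesis hX : forall i, discrete_rv (X i).

Definition restr (T : {set 'I_n}) (x : {ffun 'I_n -> S}) :
  {ffun {i : 'I_n | i \in T} -> S} := [ffun i => x (val i)].

Lemma subjointE T : subjoint T X = restr T \o joint X.
Proof. by apply/funext => w; apply/ffunP => i; rewrite /= !ffunE. Qed.

Lemma discrete_rv_joint : discrete_rv (joint X).
Proof.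
move=> A; rewrite (_ : _ @^-1` _ =
    \bigcup_(x in A) \bigcap_(i in setT) (X i @^-1` [set x i])).
  apply: fin_bigcup_measurable => [|x _]; first exact: finite_finset.
  apply: fin_bigcap_measurable => [|i _]; first exact: finite_finset.
  exact: hX.
apply/seteqP; split=> [w Aw|w [x Ax xw]] /=.
  by exists (joint X w) => // i _ /=; rewrite ffunE.
by rewrite (_ : joint X w = x)//; apply/ffunP => i; rewrite ffunE; exact: xw.
Qed.

(** The values of coordinate [i] compatible with the assignment [a] on [T].
    Quantifying over the elements of the sigma-type lying above [i] makes this
    the full set when [i] is outside [T]. *)
Definition coord_set {T : {set 'I_n}} (a : {ffun {i : 'I_n | i \in T} -> S})
  (i : 'I_n) : set S := [set s | forall j, val j = i -> s = a j].

Lemma coord_setT (T : {set 'I_n}) (a : {ffun {i : 'I_n | i \in T} -> S}) i :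
  i \notin T -> coord_set a i = setT.
Proof.
move=> iT; apply/seteqP; split=> // s _ j ji.
by move: (valP j); rewrite ji (negbTE iT).
Qed.

Lemma restr_eqP (T : {set 'I_n}) (a : {ffun {i : 'I_n | i \in T} -> S}) w :
  restr T (joint X w) = a <-> forall i, coord_set a i (X i w).
Proof.
split=> [<- i j <-|aw]; first by rewrite !ffunE.
by apply/ffunP => j; rewrite !ffunE; exact: aw.
Qed.

Lemma restr_eq_bigcap (T : {set 'I_n}) (a : {ffun {i : 'I_n | i \in T} -> S}) :
  joint X @^-1` [set x | restr T x == a]
  = \bigcap_(i in [set` T]) (X i @^-1` coord_set a i).
Proof.
apply/seteqP; split=> w /=; first by move/eqP/restr_eqP=> aw i _; exact: aw.
move=> aw.
apply/eqP/restr_eqP => i; have [iT|iT] := boolP (i \in T); first exact: aw.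
by rewrite coord_setT.
Qed.

(** Fixing both restrictions is a condition on each coordinate separately, so
    independence over the union of [T1] and [T2] turns its probability into a
    product over the union, which splits along [T1] and [T2].  Applied to [T1]
    and [T2] alone, independence identifies the two factors. *)
Lemma indep_restr k (T1 T2 : {set 'I_n}) :
  kwise_independent P k X -> [disjoint T1 & T2]%B -> (#|T1| + #|T2| <= k)%N ->
  indep (law P (joint X)) (restr T1) (restr T2).
Proof.
move=> hind dT cT a b; apply: EFin_inj; rewrite EFinM.
have mJ := discrete_rv_joint.
rewrite -!prob_law// !restr_eq_bigcap.
rewrite !hind ?(leq_trans _ cT) ?leq_addr ?leq_addl//.
have -> : joint X @^-1` [set x | (restr T1 x == a) && (restr T2 x == b)]
  = \bigcap_(i in [set` T1 :|: T2])
      (X i @^-1` (coord_set a i `&` coord_set b i)).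
  apply/seteqP; split=> w /=.
    move=> /andP[/eqP/restr_eqP aw /eqP/restr_eqP bw] i _.
    by split; [exact: aw|exact: bw].
  move=> abw; have ab i : (coord_set a i `&` coord_set b i) (X i w).
    have [iT|] := boolP (i \in T1 :|: T2); first exact: abw.
    by rewrite finset.in_setU => /norP[i1 i2]; rewrite !coord_setT.
  by apply/andP; split; apply/eqP/restr_eqP => i; have [] := ab i.
rewrite hind; last by rewrite (leq_trans _ cT)// leq_card_setU.
rewrite (eq_bigl _ _ (fun i => finset.in_setU i T1 T2)) bigU//=.
congr (_ * _)%E; apply: eq_bigr => i iT.
  by rewrite (coord_setT _ b) ?setIT// (disjointFr dT).
by rewrite (coord_setT _ a) ?setTI// (disjointFl dT).
Qed.

Lemma pivotalP (p alpha : R) f T :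
  pivotal P p alpha f X T <->
  p < prob (law P (joint X))
        (fun x => alpha < `|deviation (law P (joint X)) (restr T) f x|).
Proof.
have mJ := discrete_rv_joint; rewrite /pivotal -lte_fin -prob_law//.
rewrite (_ : [set w | _] = joint X @^-1` [set x |
  alpha < `|deviation (law P (joint X)) (restr T) f x|])//.
apply/seteqP; split=> w /=;
  by rewrite /deviation subjointE condexp_law// expect_law.
Qed.

(** The restriction to no coordinates is constant, so conditioning on it
    changes nothing. *)
Lemma not_pivotal0 (p alpha : R) f :
  0 <= p -> 0 <= alpha -> ~ pivotal P p alpha f X finset.set0.
Proof.
move=> p0 a0 /pivotalP; apply/negP; rewrite -leNgt /prob big1// => x.
rewrite deviation_cst ?normr0; first by rewrite ltNge a0.
  exact/sum_law/discrete_rv_joint.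
by move=> y z; apply/ffunP => j; have := valP j; rewrite finset.in_set0.
Qed.

End Restriction.

(** * A maximal packing of pivotal sets *)

Theorem theorem2p7 (R : realType) (d : measure_display)
    (Omega : measurableType d) (P : probability Omega R)
    (m : nat) (S : finType) (n : nat) (X : 'I_n -> Omega -> S)
    (hX : forall i : 'I_n, discrete_rv (X i))
    (hind : kwise_independent P (2 * m)%N X)
    (alpha p : R) (halpha : 0 < alpha < 1) (hp : 0 < p < 1)
    (f : {ffun 'I_n -> S} -> R)
    (hf : forall x : {ffun 'I_n -> S}, -1 <= f x <= 1) :
  exists C : {set 'I_n},
    #|C|%:R <= 8 * m%:R / (p * alpha ^+ 2) /\
    forall T : {set 'I_n}, T \subset ~: C -> (#|T| <= m)%N ->
      ~ pivotal P p alpha f X T.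
Proof.
have [/andP[a0 _] /andP[p0 _]] := (halpha, hp).
have mJ := discrete_rv_joint X hX.
pose small_pivotal (T : {set 'I_n}) :=
  (#|T| <= m)%N && `[< pivotal P p alpha f X T >].
pose packing (F : {set {set 'I_n}}) :=
  finset.trivIset F && [forall T in F, small_pivotal T].
have packing0 : packing finset.set0.
  apply/andP; split; last by apply/forall_inP => T; rewrite finset.in_set0.
  by apply/finset.trivIsetP => A B; rewrite finset.in_set0.
case: (arg_maxnP (fun F : {set {set 'I_n}} => #|F|) packing0).
move=> F /andP[tF /forall_inP sF] maxF.
have card_small T : T \in F -> (#|T| <= m)%N by move=> /sF/andP[].
exists (finset.cover F); split.
  have pa0 : 0 < p * alpha ^+ 2 by rewrite mulr_gt0// exprn_gt0.
  have cF : #|F|%:R * (p * alpha ^+ 2) <= 1.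
    apply: (card_large_deviation _ (law_ge0 P _) (sum_law P _ mJ) F _ restr f p
              alpha hf a0).
      move=> T1 T2 F1 F2 T12; apply: (indep_restr P X hX _ _ _ hind).
        by move/finset.trivIsetP: tF; apply.
      by rewrite mul2n -addnn leq_add ?card_small.
    by move=> T /sF/andP[_ /asboolP/(pivotalP P X hX)].
  rewrite ler_pdivlMr//.
  have : (#|finset.cover F| <= m * #|F|)%N.
    rewrite mulnC -sum_nat_const (leq_trans (leq_card_cover F).1)//.
    exact: leq_sum card_small.
  rewrite -(ler_nat R) natrM => cC.
  apply: (@le_trans _ _ (m%:R * #|F|%:R * (p * alpha ^+ 2))).
    by rewrite ler_wpM2r// ltW.
  have m0 : 0 <= m%:R :> R by [].
  by nra.
(* A small pivotal [T] outside the cover would enlarge the packing. *)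
move=> T TC cT pT.
have T_F B : B \in F -> [disjoint T & B]%B.
  move=> BF; rewrite finset.disjoints_subset (fintype.subset_trans TC)//.
  by rewrite finset.setCS finset.bigcup_sup.
have F0 : finset.set0 \notin F.
  apply/negP => /sF/andP[_ /asboolP].
  exact: (not_pivotal0 P X hX p alpha f (ltW p0) (ltW a0)).
have [tTF TF] := finset.trivIsetU1 T_F tF F0.
have /maxF : packing (T |: F)%SET.
  apply/andP; split => //; apply/forall_inP => B /finset.setU1P[->|/sF//].
  by apply/andP; split => //; apply/asboolP.
by rewrite /= finset.cardsU1 TF add1n ltnn.
Qed.
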